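(* Let $A$ be an abelian group and $G=\operatorname{Aut}(A)$, acting on $A$ by the natural action. Let $q\in\mathbb{Z}$ be such that $q\,\mathrm{Id}_A:A\to A$ is an automorphism. Then $(q-1)^2$ annihilates $H^2(G,A)$ (cohomology for the natural action). As a consequence, let $p$ be a prime, let $\underline{\lambda}=(\lambda_1^{\rho_1}>\lambda_2^{\rho_2}>\cdots>\lambda_k^{\rho_k})$ be a partition, let $\mathcal{A}_{\underline{\lambda}}=\bigoplus_{i=1}^k(\mathbb{Z}/p^{\lambda_i}\mathbb{Z})^{\rho_i}$ and $\mathcal{G}_{\underline{\lambda}}=\operatorname{Aut}(\mathcal{A}_{\underline{\lambda}})$ acting naturally on $\mathcal{A}_{\underline{\lambda}}$. Then: (a) if $p\neq 2$, then $H^2(\mathcal{G}_{\underline{\lambda}},\mathcal{A}_{\underline{\lambda}})=0$; (b) if $p=2$, then $H^2(\mathcal{G}_{\underline{\lambda}},\mathcal{A}_{\underline{\lambda}})$ is a direct sum of finitely many (possibly zero) copies of $\mathbb{Z}/2\mathbb{Z}$ and finitely many (possibly zero) copies of $\mathbb{Z}/4\mathbb{Z}$.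
   Context: The natural action of $\operatorname{Aut}(A)$ on $A$ is $g\cdot a=g(a)$. A partition $\underline{\lambda}=(\lambda_1^{\rho_1}>\cdots>\lambda_k^{\rho_k})$ consists of positive integers $\lambda_1>\lambda_2>\cdots>\lambda_k$ (the distinct parts) with positive integer multiplicities $\rho_1,\dots,\rho_k$, $k\geq 1$. $H^i(G,A)$ denotes ordinary group cohomology. *)

(* Defs.v *)
From HB Require Import structures.
From mathcomp Require Import all_boot all_order all_algebra.
From mathcomp Require Import boolp functions.

Set Implicit Arguments.
Unset Strict Implicit.
Unset Printing Implicit Defensive.

Import GRing.Theory.
Local Open Scope ring_scope.

(* Multiplication is composition: (g * h) a = g (h a). *)

Record abAut (A : zmodType) := AbAut {
  aut_fun :> {additive A -> A};
  aut_bij : bijective aut_fun }.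

HB.instance Definition _ (A : zmodType) := gen_eqMixin (abAut A).
HB.instance Definition _ (A : zmodType) := gen_choiceMixin (abAut A).

Section AutGroup.
Variable A : zmodType.
Implicit Types g h : abAut A.

Lemma autP g h : (forall a, g a = h a) -> g = h.
Proof.
case: g h => [g gbij] [h hbij] /= gh.
have {}gh : g = h.
  have /= fgh : (g : A -> A) = h by apply/funext.
  case: g h fgh {gbij hbij gh} => [f [[fD]]] [f' [[fD']]] /= ff'.
  by case: f' / ff' fD' => fD'; rewrite (Prop_irrelevance fD fD').
by case: h / gh hbij => hbij; rewrite (Prop_irrelevance gbij hbij).
Qed.

Definition aut_one : abAut A :=
  @AbAut A (idfun : {additive A -> A}) (inv_bij (fun a => erefl a)).

Definition aut_mul g h : abAut A :=
  @AbAut A ((g : A -> A) \o (h : A -> A) : {additive A -> A})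
    (bij_comp (aut_bij g) (aut_bij h)).

Lemma aut_inv_ex g : exists h, cancel g h /\ cancel h g.
Proof.
have [f gf fg] := aut_bij g.
have fB : zmod_morphism f by move=> a b; rewrite -{1}(fg a) -{1}(fg b) -raddfB gf.
pose fa := GRing.isZmodMorphism.Build A A f fB.
pose F : {additive A -> A} := HB.pack f fa.
by exists (@AbAut A F (Bijective (fg : cancel F g) gf)).
Qed.

Definition aut_inv g : abAut A := projT1 (cid (aut_inv_ex g)).

Lemma autK g : cancel g (aut_inv g).
Proof. exact: (projT2 (cid (aut_inv_ex g))).1. Qed.

Lemma autVK g : cancel (aut_inv g) g.
Proof. exact: (projT2 (cid (aut_inv_ex g))).2. Qed.

Lemma aut_mulA : associative aut_mul.
Proof. by move=> g h k; apply: autP. Qed.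

Lemma aut_mul1 : left_id aut_one aut_mul.
Proof. by move=> g; apply: autP. Qed.

Lemma aut_mulr1 : right_id aut_one aut_mul.
Proof. by move=> g; apply: autP. Qed.

Lemma aut_mulV : left_inverse aut_one aut_inv aut_mul.
Proof. by move=> g; apply: autP => a; exact: autK. Qed.

Lemma aut_mulrV : right_inverse aut_one aut_inv aut_mul.
Proof. by move=> g; apply: autP => a; exact: autVK. Qed.

HB.instance Definition _ := isGroup.Build (abAut A)
  aut_mulA aut_mul1 aut_mulr1 aut_mulV aut_mulrV.

End AutGroup.

(* Left G-modules. *)
Record gmodule (G : groupType) (A : zmodType) := GModule {
  gact :> G -> {additive A -> A};
  gact1 : forall a, gact 1%g a = a;
  gactM : forall g h a, gact (g * h)%g a = gact g (gact h a) }.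

(* H^n(G, A) is computed from inhomogeneous cochains (the bar resolution). *)
Section Cohomology.
Variables (G : groupType) (A : zmodType) (M : gmodule G A).

Definition cochain (n : nat) : zmodType := ('I_n -> G) -> A.

(* (g_0, ..., g_n) |-> (g_0, ..., g_i * g_(i+1), ..., g_n) *)
Definition face_mul n (i : 'I_n) (g : 'I_n.+1 -> G) : 'I_n -> G := fun j =>
  if (j < i)%N then g (lift ord_max j)
  else if j == i then (g (lift ord_max j) * g (lift ord0 j))%g
  else g (lift ord0 j).

(* (d f)(g_0, ..., g_n) = g_0 . f(g_1, ..., g_n)
     + \sum_(0 <= i < n) (-1)^(i+1) f(..., g_i * g_(i+1), ...)
     + (-1)^(n+1) f(g_0, ..., g_(n-1)) *)
Definition cobord n (f : cochain n) : cochain n.+1 := fun g =>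
  M (g ord0) (f (g \o lift ord0))
  + \sum_(i < n) f (face_mul i g) *~ (-1) ^+ i.+1
  + f (g \o lift ord_max) *~ (-1) ^+ n.+1.

Lemma cobordB n : zmod_morphism (@cobord n).
Proof.
move=> f f'; apply/funext => g.
have E m (u v : cochain m) h : (u - v) h = u h - v h by [].
rewrite E /cobord E raddfB mulrzBl.
under eq_bigr do rewrite E mulrzBl.
rewrite sumrB !opprD [X in X + _ = _]addrACA.
exact: addrACA.
Qed.

Definition cocycle_pred n : {pred cochain n} := fun f => cobord f == 0.

Lemma cocycle_closed n : zmod_closed (@cocycle_pred n).
Proof.
split=> [|f f']; rewrite !unfold_in /cocycle_pred.
  by rewrite -(subrr (0 : cochain n)) cobordB subrr.
by move=> /eqP f0 /eqP f0'; rewrite cobordB f0 f0' subrr.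
Qed.

HB.instance Definition _ n :=
  GRing.isZmodClosed.Build (cochain n) (@cocycle_pred n) (@cocycle_closed n).

Record cocycle n := Cocycle {
  cocycle_val :> cochain n;
  cocycle_valP : cocycle_val \in @cocycle_pred n }.

HB.instance Definition _ n := [isSub for @cocycle_val n].
HB.instance Definition _ n := [Choice of cocycle n by <:].
HB.instance Definition _ n := [SubChoice_isSubZmodule of cocycle n by <:].

Definition is_coboundary n : cochain n -> Prop :=
  match n with
  | 0 => fun f => f = 0 (* no cochains in degree -1 *)
  | m.+1 => fun f => exists b : cochain m, f = cobord b
  end.

Definition coboundary n : {pred cocycle n} :=
  fun z => `[< is_coboundary (z : cochain n) >].

Lemma coboundary_closed n : zmod_closed (@coboundary n).
Proof.
split=> [|z z']; rewrite !unfold_in /coboundary.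
  apply/asboolP; case: n => [//|n] /=.
  by exists 0; rewrite -(subrr (0 : cochain n)) cobordB subrr.
move=> /asboolP zb /asboolP zb'; apply/asboolP.
have zz' : cocycle_val (z - z') = cocycle_val z - cocycle_val z' := raddfB val z z'.
rewrite {}zz'; case: n z z' zb zb' => [|n] z z' /=.
  by move=> -> ->; rewrite subrr.
by move=> [b ->] [b' ->]; exists (b - b'); rewrite cobordB.
Qed.

HB.instance Definition _ n :=
  GRing.isZmodClosed.Build (cocycle n) (@coboundary n) (@coboundary_closed n).

Definition cohomology n : zmodType := Quotient.quot (@coboundary n).

End Cohomology.

Definition natural_gmodule (A : zmodType) : gmodule (abAut A) A :=
  @GModule (abAut A) A (@aut_fun A) (fun=> erefl) (fun _ _ _ => erefl).

Section DirectSum.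
Variables (I : finType) (B : I -> zmodType).

(* I is finite, so the direct sum is the full product. *)
Definition dirsum : Type := forall i, B i.

HB.instance Definition _ := Choice.on dirsum.

Definition dirsum_add (x y : dirsum) : dirsum := fun i => x i + y i.
Definition dirsum_opp (x : dirsum) : dirsum := fun i => - x i.
Definition dirsum_zero : dirsum := fun=> 0.

Lemma dirsum_addA : associative dirsum_add.
Proof. by move=> x y z; apply: functional_extensionality_dep => i; exact: addrA. Qed.

Lemma dirsum_addC : commutative dirsum_add.
Proof. by move=> x y; apply: functional_extensionality_dep => i; exact: addrC. Qed.

Lemma dirsum_add0 : left_id dirsum_zero dirsum_add.
Proof. by move=> x; apply: functional_extensionality_dep => i; exact: add0r. Qed.

Lemma dirsum_addN : left_inverse dirsum_zero dirsum_opp dirsum_add.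
Proof. by move=> x; apply: functional_extensionality_dep => i; exact: addNr. Qed.

HB.instance Definition _ := GRing.isZmodule.Build dirsum
  dirsum_addA dirsum_addC dirsum_add0 dirsum_addN.

End DirectSum.

(* The distinct parts are the lam i, and rho i is the multiplicity of lam i. *)
Definition is_partition (k : nat) (lam rho : 'I_k -> nat) : Prop :=
  [/\ (0 < k)%N,
      forall i j : 'I_k, (i < j)%N -> (lam j < lam i)%N,
      forall i, (0 < lam i)%N
    & forall i, (0 < rho i)%N].

(* 'Z_m has max(m, 2) elements; for p prime and lam i > 0 it is Z / p ^ lam i. *)
Definition abelian_pgroup (p k : nat) (lam rho : 'I_k -> nat) : zmodType :=
  dirsum (fun i : 'I_k => 'rV['Z_(p ^ lam i)]_(rho i)).

Definition zmod_isom (A B : zmodType) : Prop :=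
  exists f : {additive A -> B}, bijective f.

(* Main.v *)
(* A central element z of G acts trivially on H^2(G, A): for a 2-cocycle f, the
   1-cochain b(g) = f(z, g) - f(g, z) satisfies z f - f = d b, by the alternating
   sum of the cocycle identities at (z, g, h), (g, z, h) and (g, h, z).  When z
   acts as multiplication by q this says that q - 1 already annihilates H^2.  For
   A a finite abelian p-group, take q = 2 if p is odd, so that H^2 = 0, and q = 3
   if p = 2, so that H^2 is a finite elementary abelian 2-group: no copy of Z/4
   occurs. *)
Require Import Defs.
From HB Require Import structures.
From mathcomp Require Import all_boot all_order all_algebra.
From mathcomp Require Import boolp functions.

Import GRing.Theory.
Local Open Scope ring_scope.

Section CentralElement.
Variables (G : groupType) (A : zmodType) (M : gmodule G A).

Definition args1 (g : G) : 'I_1 -> G := fun=> g.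
Definition args2 (g h : G) : 'I_2 -> G := fun i => nth 1%g [:: g; h] i.
Definition args3 (g h k : G) : 'I_3 -> G := fun i => nth 1%g [:: g; h; k] i.

(** With [args2E], this normalises the tuples that [lift] and [face_mul] produce inside [cobord], so
    that the bar differential takes its usual explicit form. *)
Lemma args1E (u : 'I_1 -> G) : u = args1 (u ord0).
Proof. by apply/funext => i; rewrite (ord1 i). Qed.

Lemma args2E (u : 'I_2 -> G) : u = args2 (u ord0) (u ord_max).
Proof.
by apply/funext => -[[|[|//]] i2]; rewrite /args2 /=; congr u; exact: val_inj.
Qed.

Lemma cobord1E (b : cochain G A 1) g h :
  cobord M b (args2 g h) =
  M g (b (args1 h)) - b (args1 (g * h)%g) + b (args1 g).
Proof.
rewrite /cobord big_ord1 [args2 g h \o lift ord0]args1E.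
by rewrite [face_mul _ _]args1E [args2 g h \o lift ord_max]args1E.
Qed.

Lemma cobord2E (f : cochain G A 2) g h k :
  cobord M f (args3 g h k) =
  M g (f (args2 h k)) - f (args2 (g * h)%g k) + f (args2 g (h * k)%g)
  - f (args2 g h).
Proof.
rewrite /cobord !big_ord_recl big_ord0 addr0 [args3 g h k \o lift ord0]args2E.
rewrite [face_mul ord0 _]args2E [face_mul (lift _ _) _]args2E.
by rewrite [args3 g h k \o lift ord_max]args2E addrA.
Qed.

Lemma central_act_cobord (z : G) (f : cochain G A 2) :
  (forall g, z * g = g * z)%g -> cobord M f = 0 ->
  exists b : cochain G A 1, forall u, M z (f u) - f u = cobord M b u.
Proof.
move=> zC f0.
exists (fun v => f (args2 z (v ord0)) - f (args2 (v ord0) z)) => u.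
rewrite [u]args2E; set g := u ord0; set h := u ord_max.
(* The cocycle identity at (x, y, k), solved for the term on which x acts. *)
have fE x y k : M x (f (args2 y k)) =
    f (args2 (x * y)%g k) - f (args2 x (y * k)%g) + f (args2 x y).
  have /eqP := congr1 (fun F => F (args3 x y k)) f0.
  rewrite cobord2E subr_eq0 => /eqP <-.
  by rewrite addrC addrA [_ + f _ + f _]addrAC subrK addrK.
rewrite cobord1E /args1 raddfB !fE !zC !opprD !opprK !addrA.
(* The permutation puts the four terms of the left side first, followed by three cancelling
   pairs. *)
by rewrite [RHS](ACl (1*7*9*6*2*5*3*10*4*8)) /= subrK addrK subrK.
Qed.

Lemma cochainMz n (f : cochain G A n) (m : int) u : (f *~ m) u = f u *~ m.
Proof.
have fMn k : (f *+ k) u = f u *+ k.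
  by elim: k => // k IHk; rewrite !mulrS -IHk.
by case: m => k; rewrite ?NegzE ?mulrNz -?pmulrn -fMn.
Qed.

Lemma cohomology_eq0 n (f : cocycle M n) :
  is_coboundary M (f : cochain G A n) ->
  \pi_(cohomology M n)%qT f = 0.
Proof.
move=> fb; have fB : f - 0 \in @coboundary G A M n.
  by rewrite subr0; apply/asboolP.
rewrite Quotient.idealrBE in fB.
by rewrite (eqP fB) raddf0.
Qed.

Lemma central_mulz_cohomology2 (z : G) (q : int) :
  (forall g, z * g = g * z)%g -> (forall a, M z a = a *~ q) ->
  forall c : cohomology M 2, c *~ (q - 1) = 0.
Proof.
move=> zC zq c; rewrite -[c]generic_quotient.reprK.
set f := generic_quotient.repr c.
have f0 : cobord M (f : cochain G A 2) = 0 by apply/eqP; exact: cocycle_valP.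
have [b fb] := central_act_cobord z f zC f0.
have fMz : cocycle_val (f *~ (q - 1)) = (f : cochain G A 2) *~ (q - 1).
  exact: (raddfMz val).
rewrite -raddfMz; apply: cohomology_eq0; exists b; apply/funext => u.
by rewrite fMz cochainMz -fb zq mulrzBr mulr1z.
Qed.

End CentralElement.

Section FiniteTypes.

(** Automorphism groups and cohomology groups carry no [finType] structure, so finiteness is stated
    as embeddability in a finite type. *)
Definition finitely_many (T : Type) : Prop :=
  exists (F : finType) (f : T -> F), injective f.

Lemma finitely_many_fin (F : finType) : finitely_many F.
Proof. by exists F, id. Qed.

Lemma finitely_many_inj (S T : Type) (h : S -> T) :
  injective h -> finitely_many T -> finitely_many S.
Proof. by move=> h_inj [F [f f_inj]]; exists F, (f \o h); exact: inj_comp. Qed.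

Lemma finitely_many_fun (S T : Type) :
  finitely_many S -> finitely_many T -> finitely_many (S -> T).
Proof.
move=> [E [e e_inj]] [F [f f_inj]].
(* A function is determined by its graph, transported here to a subset of [E * F]. *)
exists {set E * F}, (fun h => [set u | `[< exists x, u = (e x, f (h x)) >]]).
move=> h h' /setP hh'; apply/funext => x.
have := hh' (e x, f (h x)); rewrite !inE.
have -> : `[< exists y, (e x, f (h x)) = (e y, f (h y)) >].
  by apply/asboolP; exists x.
by move/esym/asboolP => [y [/e_inj <- /f_inj]].
Qed.

(** A class is determined by its chosen representative cocycle, hence by a cochain, and cochains are
    functions between finite types. *)
Lemma finitely_many_cohomology (G : groupType) (A : zmodType)
    (M : gmodule G A) n :
  finitely_many G -> finitely_many A -> finitely_many (cohomology M n).
Proof.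
move=> finG finA.
apply: (@finitely_many_inj _ (cochain G A n)
          (fun c => cocycle_val (generic_quotient.repr c))).
  apply: inj_comp; first exact: val_inj.
  exact: (can_inj generic_quotient.reprK).
by do !apply: finitely_many_fun => //; exact: finitely_many_fin.
Qed.

Lemma finitely_many_aut (A : zmodType) :
  finitely_many A -> finitely_many (abAut A).
Proof.
move=> finA.
apply: (@finitely_many_inj _ (A -> A) (fun g : abAut A => g : A -> A)).
  by move=> g h gh; apply: autP => a; rewrite gh.
exact: finitely_many_fun.
Qed.

Lemma finitely_many_abelian_pgroup (p k : nat) (lam rho : 'I_k -> nat) :
  finitely_many (abelian_pgroup p lam rho).
Proof.
pose F : finType := {dffun forall i : 'I_k, 'rV['Z_(p ^ lam i)]_(rho i)}.
apply: (@finitely_many_inj _ F (fun x => [ffun i => x i])).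
  move=> x y /ffunP xy; apply: functional_extensionality_dep => i.
  by have := xy i; rewrite !ffunE.
exact: finitely_many_fin.
Qed.

End FiniteTypes.

(* A maximal injection of some (Z/2)^m into V is onto: a vector x outside the
   image would extend it to (Z/2)^(m+1). *)
Lemma elementary_abelian2 (V : zmodType) :
  finitely_many V -> (forall x : V, x *+ 2 = 0) ->
  exists m, zmod_isom V 'rV['Z_2]_m.
Proof.
move=> [F [e e_inj]] V2.
apply: contrapT => noiso.
have step m : exists f : {additive 'rV['Z_2]_m -> V}, injective f.
  elim: m => [|m [f f_inj]].
    exists (\0 : {additive 'rV['Z_2]_0 -> V}) => //.
    by move=> u v _; rewrite !thinmx0.
  (* If [f] were onto, its inverse would be the isomorphism excluded by [noiso]. *)
  have [x xf] : exists x, forall u, f u <> x.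
    apply: contrapT => surj; apply: noiso; exists m.
    have h : forall y, exists u, f u = y.
      move=> y; apply: contrapT => nu; apply: surj; exists y => u fu.
      by apply: nu; exists u.
    have {h} [g gK] := boolp.choice h.
    have fK : cancel f g by move=> u; apply: f_inj; rewrite gK.
    have gB : zmod_morphism g by move=> a b; apply: f_inj; rewrite raddfB !gK.
    pose ga := GRing.isZmodMorphism.Build V _ g gB.
    pose G : {additive V -> 'rV['Z_2]_m} := HB.pack g ga.
    by exists G; exists f.
  (* The new first coordinate is the coefficient of x. This is additive because 2x = 0, and
     injective because x is not in the image of [f]. *)
  pose h (w : 'rV['Z_2]_(1 + m)) := x *+ (lsubmx w 0 0 : nat) + f (rsubmx w).
  have xD (a b : 'Z_2) : x *+ (a - b)%R = x *+ a - x *+ b.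
    have xN : - x = x by apply/eqP; rewrite eq_sym -addr_eq0 -mulr2n V2.
    by case: a b => [[|[|//]] a2] [[|[|//]] b2];
      rewrite /= ?mulr0n ?mulr1n ?subrr ?subr0 ?sub0r ?xN.
  have hB : zmod_morphism h.
    move=> a b; rewrite /h !linearB /= !mxE xD opprD addrACA.
    by rewrite raddfB.
  pose ha := GRing.isZmodMorphism.Build _ V h hB.
  pose H : {additive 'rV['Z_2]_(1 + m) -> V} := HB.pack h ha.
  exists H; apply: raddf_inj; rewrite /H /=.
  suff h0 (w : 'rV['Z_2]_(1 + m)) : h w = 0 -> w = 0 by exact: h0.
  rewrite /h; have [l0 | l1] : lsubmx w 0 0 = 0 \/ lsubmx w 0 0 = 1.
    by case: (lsubmx w 0 0) => [[|[|//]] i]; [left | right]; exact: val_inj.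
  - rewrite l0 mulr0n add0r -[X in _ = X -> _](raddf0 f) => /f_inj r0.
    apply/eqP; rewrite -[w]hsubmxK row_mx_eq0 r0 eqxx andbT.
    by apply/eqP/matrixP => i j; rewrite !ord1 l0 mxE.
  rewrite l1 mulr1n => /eqP; rewrite addr_eq0 -raddfN => /eqP fw.
  by case: (xf (- rsubmx w)).
(* At m = #|F| the injection would give 2 ^ #|F| <= #|F|. *)
have [f f_inj] := step #|F|.
have := leq_card _ (inj_comp e_inj f_inj).
by rewrite card_mx card_ord mul1n leqNgt ltn_expl.
Qed.

(** Multiplication by q is central in the automorphism group, since every automorphism is
    additive. *)
Lemma natural_cohomology2_mulz (A : zmodType) (q : int) :
  (exists g : abAut A, forall a : A, g a = a *~ q) ->
  forall c : cohomology (natural_gmodule A) 2, c *~ (q - 1) = 0.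
Proof.
move=> [z zq]; apply: (central_mulz_cohomology2 _ _ _ z) => // g.
by apply: autP => a /=; rewrite !zq raddfMz.
Qed.

Lemma abelian_pgroup_mulz_aut (p k : nat) (lam rho : 'I_k -> nat) (q : nat) :
  prime p -> is_partition lam rho -> coprime p q ->
  exists g : abAut (abelian_pgroup p lam rho), forall a, g a = a *~ q.
Proof.
move=> p_prime [_ _ lam_gt0 _] cop.
set A := abelian_pgroup p lam rho.
have mB : zmod_morphism (fun a : A => a *+ q) by move=> a b; rewrite mulrnBl.
pose ma := GRing.isZmodMorphism.Build A A _ mB.
pose m : {additive A -> A} := HB.pack (fun a : A => a *+ q) ma.
have mE (a : A) i : (a *+ q) i = (q%:R : 'Z_(p ^ lam i)) *: a i.
  rewrite scaler_nat.
  by elim: (q) => // n IHn; rewrite !mulrS -IHn.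
have q_unit i : (q%:R : 'Z_(p ^ lam i)) \is a GRing.unit.
  rewrite unitZpE ?coprimeXl //.
  (* The criterion for units of ['Z_m] asks for m > 1; here 1 < p ^ lam i because [lam i] is
     positive. *)
  by rewrite -(exp1n (lam i)) ltn_exp2r ?prime_gt1.
pose m' : A -> A := fun a i => (q%:R : 'Z_(p ^ lam i))^-1 *: a i.
have mK : cancel m m'.
  move=> a; apply: functional_extensionality_dep => i.
  by rewrite /m' /= mE scalerA (mulVr (q_unit i)) scale1r.
have m'K : cancel m' m.
  move=> a; apply: functional_extensionality_dep => i.
  by rewrite [LHS]mE scalerA (mulrV (q_unit i)) scale1r.
by exists (@AbAut A m (Bijective mK m'K)).
Qed.

Theorem theorem4p1 :
  (forall (A : zmodType) (q : int),
     (exists g : abAut A, forall a : A, g a = a *~ q) ->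
     forall c : cohomology (natural_gmodule A) 2, c *~ ((q - 1) ^+ 2) = 0)
  /\
  (forall (p k : nat) (lam rho : 'I_k -> nat),
     prime p -> is_partition lam rho ->
     (p <> 2%N ->
        forall c : cohomology (natural_gmodule (abelian_pgroup p lam rho)) 2, c = 0)
     /\
     (p = 2%N ->
        exists m n : nat,
          zmod_isom (cohomology (natural_gmodule (abelian_pgroup p lam rho)) 2)
                    ('rV['Z_2]_m * 'rV['Z_4]_n)%type)).
Proof.
split=> [A q qA c|p k lam rho p_prime lamP].
  by rewrite expr2 mulrzA natural_cohomology2_mulz ?mul0rz.
have kill (q : nat) : coprime p q ->
    forall c : cohomology (natural_gmodule (abelian_pgroup p lam rho)) 2,
    c *~ (q%:Z - 1) = 0.
  move=> cop; apply: natural_cohomology2_mulz.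
  exact: (abelian_pgroup_mulz_aut p k lam rho).
split=> [/eqP p2 c|p2].
  (* For q = 2 the annihilator q - 1 is 1. *)
  have cop : coprime p 2 by rewrite prime_coprime // dvdn_prime2.
  by have := kill _ cop c; rewrite mulr1z.
have cop : coprime p 3 by rewrite p2.
have finA := finitely_many_abelian_pgroup p k lam rho.
have finG := finitely_many_aut _ finA.
have finH := finitely_many_cohomology _ _ (natural_gmodule _) 2 finG finA.
(* For q = 3, [c *~ (q - 1)] computes to [c *+ 2]. *)
have [m [f f_bij]] := elementary_abelian2 _ finH (kill _ cop).
have [f' fK f'K] := f_bij.
(* All classes are killed by 2, so the Z/4 factor is taken to be the trivial group ['rV['Z_4]_0]. *)
exists m, 0%N.
have gB : zmod_morphism (fun c => (f c, 0 : 'rV['Z_4]_0)).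
  by move=> c d; rewrite raddfB; congr pair; rewrite subr0.
pose ga := GRing.isZmodMorphism.Build _ _ _ gB.
pose g : {additive _ -> ('rV['Z_2]_m * 'rV['Z_4]_0)%type} :=
  HB.pack (fun c => (f c, 0 : 'rV['Z_4]_0)) ga.
exists g, (fun x => f' x.1) => [c|[u v]] /=; first exact: fK.
by rewrite f'K [v]thinmx0.
Qed.
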